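(* Let $a\in\mathbb{R}\setminus\{0\}$ and let $n\ge 1$ be an integer. Consider the unit circle traversed $n$ times, $\gamma_0(t)=(\cos t,\sin t)$, $t\in[0,2\pi n]$, as a critical curve of the functional $\mathcal{B}_a(\gamma)=\int_0^{2\pi n}p(t)^a\,dt$. If $a=\tfrac13$, then the $n$-fold unit circle is infinitesimally rigid. If $a\ne\tfrac13$, then a non-trivial infinitesimal deformation of the $n$-fold unit circle in the class of critical curves exists if and only if $$a=\frac{k^2-2n^2}{k^2-4n^2}$$ for some positive integer $k\neq n$ (with $k\ne 2n$).
   Context: $[\cdot,\cdot]$ denotes the determinant of two vectors in $\mathbb{R}^2$. Consider smooth $2\pi n$-periodic curves $\gamma:\mathbb{R}\to\mathbb{R}^2$ in centroaffine parameterization, $[\gamma,\gamma']=1$, with positive centroaffine curvature $p=[\gamma',\gamma'']>0$. The infinitesimal deformations of such a curve preserving $[\gamma,\gamma']=1$ are the vector fields $v_f=-\tfrac{f'}{2}\gamma+f\gamma'$ with $f$ smooth and $2\pi n$-periodic. The curve $\gamma$ is critical for $\mathcal{B}_a$ if the first variation of $\int_0^{2\pi n}[\gamma',\gamma'']^a\,dt$ in every direction $v_f$ vanishes; this is the Euler–Lagrange equation $\tfrac12F'''+2pF'+p'F=0$ with $F=p^{a-1}$. An infinitesimal deformation of $\gamma_0$ in the class of critical curves is a vector field $\gamma_1=-\tfrac{f'}{2}\gamma_0+f\gamma_0'$, $f$ smooth and $2\pi n$-periodic, such that $\Gamma=\gamma_0+\varepsilon\gamma_1$, with $p=[\Gamma',\Gamma'']$,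 satisfies the Euler–Lagrange equation modulo $\varepsilon^2$. It is trivial if it comes from the symmetries of $\mathcal{B}_a$: for $a\neq\tfrac13$ this means it is induced by the infinitesimal action of $SL(2,\mathbb{R})$, i.e. $f\in\mathrm{span}(1,\cos 2t,\sin 2t)$; for $a=\tfrac13$, parallel translations are also regarded as trivial, i.e. trivial means $f\in\mathrm{span}(1,\cos 2t,\sin 2t,\cos t,\sin t)$. The $n$-fold circle is infinitesimally rigid if it admits no non-trivial infinitesimal deformation in the class of critical curves. *)

(* Defs.v *)
From Stdlib Require Import Reals.
From Coquelicot Require Import Coquelicot.
Open Scope R_scope.

Definition smooth (f : R -> R) : Prop := forall (k : nat) (t : R), ex_derive_n f k t.

Definition periodic (T : R) (f : R -> R) : Prop := forall t : R, f (t + T) = f t.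

Definition period (n : nat) : R := 2 * PI * INR n.

Definition det (u v : R * R) : R := fst u * snd v - snd u * fst v.

Definition curve : Type := R -> R * R.

Definition smooth_curve (g : curve) : Prop :=
  smooth (fun t => fst (g t)) /\ smooth (fun t => snd (g t)).

Definition periodic_curve (T : R) (g : curve) : Prop := forall t : R, g (t + T) = g t.

Definition Dcurve (g : curve) : curve :=
  fun t => (Derive (fun s => fst (g s)) t, Derive (fun s => snd (g s)) t).

Definition curvature (g : curve) (t : R) : R := det (Dcurve g t) (Dcurve (Dcurve g) t).

Definition centroaffine_curve (n : nat) (g : curve) : Prop :=
  smooth_curve g /\ periodic_curve (period n) g /\
  (forall t : R, det (g t) (Dcurve g t) = 1) /\
  (forall t : R, 0 < curvature g t).

Definition vfield (f : R -> R) (g : curve) : curve :=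
  fun t =>
    (- (Derive f t / 2) * fst (g t) + f t * fst (Dcurve g t),
     - (Derive f t / 2) * snd (g t) + f t * snd (Dcurve g t)).

Definition deform (g g1 : curve) (eps : R) : curve :=
  fun t => (fst (g t) + eps * fst (g1 t), snd (g t) + eps * snd (g1 t)).

Definition Bfun (a : R) (n : nat) (g : curve) : R :=
  RInt (fun t => Rpower (curvature g t) a) 0 (period n).

Definition critical_curve (a : R) (n : nat) (g : curve) : Prop :=
  centroaffine_curve n g /\
  forall f : R -> R, smooth f -> periodic (period n) f ->
    is_derive (fun eps => Bfun a n (deform g (vfield f g) eps)) 0 0.

(* Left-hand side of the Euler-Lagrange equation F'''/2 + 2 p F' + p' F = 0
   with F = p^(a-1). *)
Definition EL (a : R) (p : R -> R) (t : R) : R :=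
  let F := fun s => Rpower (p s) (a - 1) in
  / 2 * Derive_n F 3 t + 2 * p t * Derive F t + Derive p t * F t.

(* h(eps) = 0 modulo eps^2, i.e. h(eps) = O(eps^2) as eps -> 0. *)
Definition zero_mod_eps2 (h : R -> R) : Prop :=
  exists C : R, locally 0 (fun eps => Rabs (h eps) <= C * eps ^ 2).

(* g + eps g1 satisfies the Euler-Lagrange equation modulo eps^2, pointwise in t.
   For fixed t the curvature is positive near t once eps is small, so the values
   of Rpower at nonpositive arguments play no role. *)
Definition infinitesimal_deformation (a : R) (n : nat) (g g1 : curve) : Prop :=
  (exists f : R -> R, smooth f /\ periodic (period n) f /\
     forall t : R, g1 t = vfield f g t) /\
  forall t : R, zero_mod_eps2 (fun eps => EL a (curvature (deform g g1 eps)) t).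

Definition circle : curve := fun t => (cos t, sin t).

Definition in_span_sl2 (f : R -> R) : Prop :=
  exists c0 c1 c2 : R, forall t : R,
    f t = c0 + c1 * cos (2 * t) + c2 * sin (2 * t).

Definition in_span_sl2_translations (f : R -> R) : Prop :=
  exists c0 c1 c2 c3 c4 : R, forall t : R,
    f t = c0 + c1 * cos (2 * t) + c2 * sin (2 * t) + c3 * cos t + c4 * sin t.

Definition trivial_circle_deformation (a : R) (g1 : curve) : Prop :=
  exists f : R -> R, (forall t : R, g1 t = vfield f circle t) /\
    ((a <> 1 / 3 /\ in_span_sl2 f) \/ (a = 1 / 3 /\ in_span_sl2_translations f)).

Definition nontrivial_circle_deformation (a : R) (n : nat) (g1 : curve) : Prop :=
  infinitesimal_deformation a n circle g1 /\ ~ trivial_circle_deformation a g1.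

Definition circle_infinitesimally_rigid (a : R) (n : nat) : Prop :=
  ~ exists g1 : curve, nontrivial_circle_deformation a n g1.

(* Main.v *)
Require Import Defs.
From Stdlib Require Import Reals ZArith Lra Lia FunctionalExtensionality.
From Coquelicot Require Import Coquelicot.
Open Scope R_scope.

(** Deforming the circle along [v_f] gives the curvature
    [1 + eps m' + eps^2 r] with [m = f''/2 + 2 f].  Hence the first variation of
    [B_a] is [a] times the integral of [m'] over a period, which vanishes, and the
    Euler-Lagrange expression is [eps] times a function of [eps] whose value at [0] is
    [(a-1)/2 m'''' + (2a-1) m''].  So [m''] is a periodic solution of
    [y'' + c y = 0] with [c = 2(2a-1)/(a-1)].  Either [m] is constant, which means
    [f] is in the span of [1, cos 2t, sin 2t], or [c = (k/n)^2] for a positive integer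
    [k], which is the stated relation between [a], [k] and [n].  For [a = 1/3] we have
    [c = 1], and the additional solutions are [f = cos t, sin t]. *)

(** * Smooth functions and their derivatives *)

Lemma smooth_ex_derive (f : R -> R) (t : R) : smooth f -> ex_derive f t.
Proof. intros H; exact (H 1%nat t). Qed.

(** [ex_derive_n] adds derivatives on the outside, whereas the product rule has to be applied to the
    innermost derivative first. *)
Lemma ex_derive_n_Derive (f : R -> R) (k : nat) (t : R) :
  (forall s, ex_derive f s) -> ex_derive_n (Derive f) k t -> ex_derive_n f (S k) t.
Proof.
  intros H1 H; destruct k as [|k]; [apply H1|].
  simpl in *.
  apply ex_derive_ext with (2 := H); intros s.
  change (Derive f) with (Derive_n f 1).
  rewrite Derive_n_comp; now replace (k + 1)%nat with (S k) by lia.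
Qed.

Lemma smooth_Derive_n (f : R -> R) (j : nat) : smooth f -> smooth (Derive_n f j).
Proof.
  intros H [|k] t; [exact I|].
  simpl; apply ex_derive_ext with (Derive_n f (k + j)).
  - intros s; now rewrite Derive_n_comp.
  - exact (H (S (k + j)) t).
Qed.

Lemma smooth_is_derive_n (f : R -> R) (k : nat) (t : R) :
  smooth f -> is_derive (Derive_n f k) t (Derive_n f (S k) t).
Proof. intros H; apply Derive_correct, (H (S k) t). Qed.

Lemma smooth_const (c : R) : smooth (fun _ => c).
Proof. intros k t; apply ex_derive_n_const. Qed.

Lemma smooth_plus (f g : R -> R) : smooth f -> smooth g -> smooth (fun t => f t + g t).
Proof.
  intros Hf Hg k t; apply ex_derive_n_plus; apply filter_forall; intros; auto.
Qed.

Lemma smooth_mult (f g : R -> R) : smooth f -> smooth g -> smooth (fun t => f t * g t).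
Proof.
  intros Hf Hg k t.
  (* The bound on all lower orders is what [ex_derive_n_plus] asks for. The induction generalizes
     over both factors because (f g)' is a sum of two other products. *)
  enough (H : forall j, (j <= k)%nat -> ex_derive_n (fun t => f t * g t) j t) by now apply H.
  revert f g Hf Hg t; induction k as [|k IH]; intros f g Hf Hg t j Hj.
  { replace j with 0%nat by lia; exact I. }
  destruct j as [|j]; [exact I|].
  apply ex_derive_n_Derive.
  { intros s; apply (ex_derive_mult f g); now apply smooth_ex_derive. }
  apply ex_derive_n_ext with (fun t => Derive f t * g t + f t * Derive g t).
  { intros s; symmetry; apply Derive_mult; now apply smooth_ex_derive. }
  apply ex_derive_n_plus; apply filter_forall; intros s i Hi; apply IH; try lia; trivial;
    now apply (smooth_Derive_n _ 1).
Qed.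

Lemma Derive_n_trig (A B w : R) (k : nat) :
  exists A' B', forall t,
    Derive_n (fun s => A * cos (w * s) + B * sin (w * s)) k t = A' * cos (w * t) + B' * sin (w * t).
Proof.
  induction k as [|k (A' & B' & IH)]; [now exists A, B|].
  exists (w * B'), (- w * A'); intros t; simpl.
  rewrite (Derive_ext _ _ _ IH).
  apply is_derive_unique; auto_derive; [trivial|ring].
Qed.

Lemma smooth_trig (A B w : R) : smooth (fun s => A * cos (w * s) + B * sin (w * s)).
Proof.
  intros [|k] t; [exact I|].
  destruct (Derive_n_trig A B w k) as (A' & B' & H).
  apply ex_derive_ext with (fun s => A' * cos (w * s) + B' * sin (w * s)); [now intros|].
  auto_derive; trivial.
Qed.

Lemma smooth_cos : smooth cos.
Proof.
  replace cos with (fun s => 1 * cos (1 * s) + 0 * sin (1 * s)); [apply smooth_trig|].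
  extensionality s; rewrite !Rmult_1_l; ring.
Qed.

Lemma smooth_sin : smooth sin.
Proof.
  replace sin with (fun s => 0 * cos (1 * s) + 1 * sin (1 * s)); [apply smooth_trig|].
  extensionality s; rewrite !Rmult_1_l; ring.
Qed.

Lemma periodic_Derive_n (T : R) (f : R -> R) (k : nat) :
  smooth f -> periodic T f -> periodic T (Derive_n f k).
Proof.
  intros Hs Hp; induction k as [|k IH]; [exact Hp|].
  intros t; simpl; rewrite <- (Derive_ext _ _ t IH).
  symmetry; apply is_derive_unique.
  evar_last.
  - apply (is_derive_comp (Derive_n f k) (fun t => t + T)).
    + apply smooth_is_derive_n, Hs.
    + auto_derive; trivial.
  - unfold scal; simpl; unfold mult; simpl; ring.
Qed.

(** * Curvature of the deformed circle *)

(* The primitive of the first-order term of the curvature of the deformed circle. *)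
Definition potential (f : R -> R) (t : R) : R := Derive_n f 2 t / 2 + 2 * f t.

(* The second-order term of the curvature of the deformed circle. *)
Definition curvature2 (f : R -> R) (t : R) : R :=
  f t * (Derive_n f 2 t / 2 + f t)
  + Derive f t / 2 * (Derive_n f 3 t / 2 + 3 / 2 * Derive f t).

Lemma smooth_potential (f : R -> R) : smooth f -> smooth (potential f).
Proof.
  intros H.
  apply (smooth_plus (fun t => Derive_n f 2 t * / 2) (fun t => 2 * f t)).
  - apply (smooth_mult (Derive_n f 2) (fun _ => / 2)); [now apply smooth_Derive_n|apply smooth_const].
  - apply (smooth_mult (fun _ => 2) f); [apply smooth_const|trivial].
Qed.

Lemma periodic_potential (T : R) (f : R -> R) :
  smooth f -> periodic T f -> periodic T (potential f).
Proof.
  intros Hs Hp t; unfold potential; now rewrite (periodic_Derive_n T f 2 Hs Hp t), (Hp t).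
Qed.

Lemma smooth_curvature2 (f : R -> R) : smooth f -> smooth (curvature2 f).
Proof.
  intros H.
  assert (H1 := smooth_Derive_n f 1 H : smooth (Derive f)).
  assert (Hh : forall k, smooth (fun t => Derive_n f k t * / 2)).
  { intros k; apply (smooth_mult (Derive_n f k) (fun _ => / 2));
      [now apply smooth_Derive_n|apply smooth_const]. }
  apply (smooth_plus (fun t => f t * (Derive_n f 2 t * / 2 + f t))
    (fun t => Derive_n f 1 t * / 2 * (Derive_n f 3 t * / 2 + 3 / 2 * Derive f t))).
  - apply (smooth_mult f (fun t => Derive_n f 2 t * / 2 + f t)); [trivial|].
    apply (smooth_plus (fun t => Derive_n f 2 t * / 2) f); trivial.
  - apply (smooth_mult (fun t => Derive_n f 1 t * / 2)
      (fun t => Derive_n f 3 t * / 2 + 3 / 2 * Derive f t)); [trivial|].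
    apply (smooth_plus (fun t => Derive_n f 3 t * / 2) (fun t => 3 / 2 * Derive f t)); [trivial|].
    apply (smooth_mult (fun _ => 3 / 2) (Derive f)); [apply smooth_const|trivial].
Qed.

Lemma Derive_potential (f : R -> R) (t : R) :
  smooth f -> Derive (potential f) t = Derive_n f 3 t / 2 + 2 * Derive f t.
Proof.
  intros H; apply is_derive_unique; unfold potential.
  assert (H0 := smooth_is_derive_n f 0 t H).
  assert (H2 := smooth_is_derive_n f 2 t H).
  change (is_derive f t (Derive f t)) in H0.
  set (f2 := Derive_n f 2) in *; set (f3 := Derive_n f 3) in *.
  change (is_derive f2 t (f3 t)) in H2.
  (* From here on the derivatives are opaque functions, linked only by [H0] and [H2]. *)
  clearbody f2 f3.
  auto_derive; [repeat split; eexists; eassumption|].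
  replace (Derive (fun x => f2 x) t) with (f3 t) by (symmetry; now apply is_derive_unique).
  change (Derive (fun x => f x) t) with (Derive f t).
  field.
Qed.

Lemma Dcurve_circle : Dcurve circle = fun t => (- sin t, cos t).
Proof.
  extensionality t; unfold Dcurve, circle; f_equal; apply is_derive_unique; simpl;
    auto_derive; trivial; ring.
Qed.

Lemma curvature_circle (t : R) : curvature circle t = 1.
Proof.
  unfold curvature; rewrite Dcurve_circle; unfold Dcurve, det; simpl.
  replace (Derive (fun s => - sin s) t) with (- cos t).
  2: symmetry; apply is_derive_unique; auto_derive; trivial; ring.
  replace (Derive (fun s => cos s) t) with (- sin t).
  2: symmetry; apply is_derive_unique; auto_derive; trivial; ring.
  assert (H := sin2_cos2 t); unfold Rsqr in H; lra.
Qed.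

(** In the moving frame e = (cos t, sin t), e' = (- sin t, cos t), where e'' = - e and [e, e'] = 1,
    the deformed curve has first derivative e' + eps ((- f''/2 - f) e + f'/2 e') and second
    derivative - e + eps ((- f'''/2 - 3/2 f') e - f e'). The determinant of the two is exactly
    quadratic in [eps]. *)
Lemma curvature_deform_circle (f : R -> R) (eps : R) : smooth f ->
  curvature (deform circle (vfield f circle) eps)
  = fun t => 1 + eps * Derive (potential f) t + eps ^ 2 * curvature2 f t.
Proof.
  intros H; extensionality t.
  rewrite Derive_potential by trivial.
  unfold curvature2, curvature, vfield; rewrite Dcurve_circle.
  assert (H0 : forall s, is_derive f s (Derive f s)) by (intros s; exact (smooth_is_derive_n f 0 s H)).
  assert (H1 : forall s, is_derive (Derive f) s (Derive_n f 2 s))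
    by (intros s; exact (smooth_is_derive_n f 1 s H)).
  assert (H2 : forall s, is_derive (Derive_n f 2) s (Derive_n f 3 s))
    by (intros s; exact (smooth_is_derive_n f 2 s H)).
  set (f1 := Derive f) in *; set (f2 := Derive_n f 2) in *; set (f3 := Derive_n f 3) in *.
  clearbody f1 f2 f3.
  assert (E0 : forall s, Derive (fun x => f x) s = f1 s) by (intros; now apply is_derive_unique).
  assert (E1 : forall s, Derive (fun x => f1 x) s = f2 s) by (intros; now apply is_derive_unique).
  assert (E2 : forall s, Derive (fun x => f2 x) s = f3 s) by (intros; now apply is_derive_unique).
  assert (ED : Dcurve (deform circle
      (fun t => (- (f1 t / 2) * fst (circle t) + f t * fst (- sin t, cos t),
                 - (f1 t / 2) * snd (circle t) + f t * snd (- sin t, cos t))) eps)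
    = fun t => (- sin t + eps * ((- f2 t / 2 - f t) * cos t - f1 t / 2 * sin t),
                cos t + eps * ((- f2 t / 2 - f t) * sin t + f1 t / 2 * cos t))).
  { extensionality s; unfold Dcurve, deform, circle; simpl; f_equal; apply is_derive_unique;
    (auto_derive; [repeat split; eexists; eauto | rewrite E0, E1; field]). }
  rewrite ED; unfold Dcurve, det; simpl.
  replace (Derive (fun s => - sin s + eps * ((- f2 s / 2 - f s) * cos s - f1 s / 2 * sin s)) t)
    with (- cos t + eps * ((- f3 t / 2 - 3 / 2 * f1 t) * cos t + f t * sin t)).
  2: { symmetry; apply is_derive_unique;
       (auto_derive; [repeat split; eexists; eauto | rewrite E0, E1, E2; field]). }
  replace (Derive (fun s => cos s + eps * ((- f2 s / 2 - f s) * sin s + f1 s / 2 * cos s)) t)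
    with (- sin t + eps * ((- f3 t / 2 - 3 / 2 * f1 t) * sin t - f t * cos t)).
  2: { symmetry; apply is_derive_unique;
       (auto_derive; [repeat split; eexists; eauto | rewrite E0, E1, E2; field]). }
  assert (HS := sin2_cos2 t); unfold Rsqr in HS.
  (* The factor sin^2 + cos^2 is [e, e'], which the determinant pulls out. *)
  transitivity ((1 + eps * (f3 t / 2 + 2 * f1 t) + eps * (eps * 1) *
    (f t * (f2 t / 2 + f t) + f1 t / 2 * (f3 t / 2 + 3 / 2 * f1 t)))
     * (sin t * sin t + cos t * cos t)); [field|rewrite HS; ring].
Qed.

(** * The Euler-Lagrange equation modulo eps^2 *)

Lemma is_derive_Rpower (b : R) (p : R -> R) (t p' : R) :
  is_derive p t p' -> 0 < p t ->
  is_derive (fun s => Rpower (p s) b) t (b * Rpower (p t) (b - 1) * p').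
Proof.
  intros H Hp; unfold Rpower; auto_derive.
  - repeat split; trivial; eexists; eauto.
  - replace (Derive (fun x => p x) t) with p' by (symmetry; now apply is_derive_unique).
    replace ((b - 1) * ln (p t)) with (b * ln (p t) + - ln (p t)) by ring.
    rewrite exp_plus, exp_Ropp, exp_ln by trivial; field; lra.
Qed.

(* Third derivative of [p^b] at a point where [p] and its first three derivatives
   are [x, x1, x2, x3]. *)
Definition Rpower_third (b x x1 x2 x3 : R) : R :=
  b * (b - 1) * (b - 2) * Rpower x (b - 3) * x1 ^ 3
  + 3 * b * (b - 1) * Rpower x (b - 2) * x1 * x2 + b * Rpower x (b - 1) * x3.

(** Positivity of [p] is assumed at [t] only, but by continuity it holds nearby. The formulas for
    the first two derivatives are therefore proved on a neighbourhood of [t], so that each can be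
    differentiated again. *)
Lemma Derive_n_3_Rpower (b : R) (p : R -> R) (t : R) : smooth p -> 0 < p t ->
  Derive_n (fun s => Rpower (p s) b) 3 t
  = Rpower_third b (p t) (Derive p t) (Derive_n p 2 t) (Derive_n p 3 t).
Proof.
  intros Hs Ht.
  assert (L : locally t (fun s => 0 < p s)).
  { apply (ex_derive_continuous p t (smooth_ex_derive p t Hs)). now apply (open_gt 0 (p t)). }
  assert (D0 : forall s, is_derive p s (Derive p s)) by (intros s; exact (smooth_is_derive_n p 0 s Hs)).
  assert (D1 : forall s, is_derive (Derive p) s (Derive_n p 2 s))
    by (intros s; exact (smooth_is_derive_n p 1 s Hs)).
  assert (D2 : forall s, is_derive (Derive_n p 2) s (Derive_n p 3 s))
    by (intros s; exact (smooth_is_derive_n p 2 s Hs)).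
  set (p1 := Derive p) in *; set (p2 := Derive_n p 2) in *; set (p3 := Derive_n p 3) in *.
  clearbody p1 p2 p3.
  assert (R1 : locally t (fun s => Derive (fun s => Rpower (p s) b) s = b * Rpower (p s) (b - 1) * p1 s)).
  { apply filter_imp with (2 := L); intros s H; apply is_derive_unique; now apply is_derive_Rpower. }
  assert (R2 : locally t (fun s => Derive_n (fun s => Rpower (p s) b) 2 s
     = b * (b - 1) * Rpower (p s) (b - 2) * p1 s ^ 2 + b * Rpower (p s) (b - 1) * p2 s)).
  { apply locally_locally in R1.
    apply filter_imp with (2 := filter_and _ _ L R1); intros s [H E].
    etransitivity; [exact (Derive_ext_loc _ _ _ E)|]; apply is_derive_unique.
    evar_last.
    - apply (is_derive_mult (fun s => b * Rpower (p s) (b - 1)) p1); [|apply D1|intros; apply Rmult_comm].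
      apply is_derive_scal, is_derive_Rpower; [apply D0|trivial].
    - unfold plus, mult; simpl. replace (b - 1 - 1) with (b - 2) by ring. ring. }
  change (Derive (Derive_n (fun s => Rpower (p s) b) 2) t
     = Rpower_third b (p t) (p1 t) (p2 t) (p3 t)).
  etransitivity; [exact (Derive_ext_loc _ _ _ R2)|]; apply is_derive_unique.
  unfold Rpower_third.
  evar_last.
  - apply @is_derive_plus.
    + apply (is_derive_mult (fun s => b * (b - 1) * Rpower (p s) (b - 2)) (fun s => p1 s ^ 2));
        [| |intros; apply Rmult_comm].
      * apply is_derive_scal, is_derive_Rpower; [apply D0|trivial].
      * apply is_derive_pow, D1.
    + apply (is_derive_mult (fun s => b * Rpower (p s) (b - 1)) p2); [|apply D2|intros; apply Rmult_comm].
      apply is_derive_scal, is_derive_Rpower; [apply D0|trivial].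
  - unfold plus, mult; simpl. replace (b - 1 - 1) with (b - 2) by ring.
    replace (b - 2 - 1) with (b - 3) by ring. ring.
Qed.

(** Dividing |h| <= C eps^2 by |eps| gives |G| <= C |eps|, so G tends to 0 and continuity yields G 0
    = 0. Conversely, if G 0 = 0, differentiability bounds |G| by a multiple of |eps|. An asymptotic
    condition on [h] thus becomes the value of [G] at one point. *)
Lemma zero_mod_eps2_factor (h G : R -> R) :
  locally 0 (fun eps => h eps = eps * G eps) -> ex_derive G 0 ->
  zero_mod_eps2 h <-> G 0 = 0.
Proof.
  intros Hh [l Hl]; split.
  - intros [C HC].
    assert (HG : is_lim G 0 (G 0)).
    { apply is_lim_continuity, derivable_continuous_pt.
      exists l; now apply is_derive_Reals. }
    assert (H0 : is_lim G 0 0).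
    { apply (is_lim_le_le_loc (fun eps => - (C * Rabs eps)) (fun eps => C * Rabs eps)).
      (* The punctured neighbourhood makes the division by |eps| legitimate. *)
      - apply (filter_imp (F := locally' 0)
          (fun eps => (h eps = eps * G eps /\ Rabs (h eps) <= C * eps ^ 2) /\ eps <> 0)).
        + intros eps [[E1 E2] E3].
          assert (P := Rabs_pos_lt eps E3).
          rewrite E1, Rabs_mult, <- Rsqr_pow2, Rsqr_abs in E2; unfold Rsqr in E2.
          assert (E4 : Rabs (G eps) <= C * Rabs eps).
          { apply Rmult_le_reg_l with (1 := P); lra. }
          apply Rabs_le_between in E4; lra.
        + apply filter_and.
          * apply filter_le_within, filter_and; trivial.
          * exists posreal_one; intros; trivial.
      - evar_last; [apply is_lim_continuity; reg|].
        cbv beta; now rewrite Rabs_R0, Rmult_0_r, Ropp_0.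
      - evar_last; [apply is_lim_continuity; reg|].
        cbv beta; now rewrite Rabs_R0, Rmult_0_r. }
    assert (E := is_lim_unique _ _ _ HG).
    rewrite (is_lim_unique _ _ _ H0) in E. now injection E.
  - intros E0.
    exists (Rabs l + 1).
    destruct Hl as [_ Hl].
    (* Taking 1 as the little-o constant, |G eps - eps l| <= |eps| near 0, which accounts for the
       bound |l| + 1. *)
    specialize (Hl 0 (fun P H => H) posreal_one).
    apply filter_imp with (2 := filter_and _ _ Hh Hl); intros eps [E1 E2].
    rewrite E1.
    unfold minus, plus, opp, scal in E2; simpl in E2; unfold norm in E2; simpl in E2.
    unfold mult, abs in E2; simpl in E2.
    rewrite E0, Ropp_0, !Rplus_0_r, Rmult_1_l in E2.
    rewrite Rabs_mult, <- Rsqr_pow2, Rsqr_abs; unfold Rsqr.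
    assert (E3 : Rabs (G eps) <= (Rabs l + 1) * Rabs eps).
    { replace (G eps) with ((G eps + - (eps * l)) + eps * l) by ring.
      apply Rle_trans with (1 := Rabs_triang _ _); rewrite (Rabs_mult eps l); lra. }
    assert (P := Rabs_pos eps); nra.
Qed.

(** The constant term dies at the first differentiation, hence the order [S k]. The common factor
    [eps] is the one split off the Euler-Lagrange expression. *)
Lemma Derive_n_quadratic (q r : R -> R) (c eps : R) (k : nat) (t : R) : smooth q -> smooth r ->
  Derive_n (fun s => c + eps * q s + eps ^ 2 * r s) (S k) t
  = eps * (Derive_n q (S k) t + eps * Derive_n r (S k) t).
Proof.
  intros Hq Hr; revert t; induction k as [|k IH]; intros t.
  - apply is_derive_unique; auto_derive.
    + repeat split; now apply smooth_ex_derive.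
    + simpl; rewrite (Derive_ext (fun x => q x) q), (Derive_ext (fun x => r x) r) by trivial; ring.
  - etransitivity; [exact (Derive_ext _ _ t IH)|].
    apply is_derive_unique.
    assert (H1 := smooth_is_derive_n q (S k) t Hq).
    assert (H2 := smooth_is_derive_n r (S k) t Hr).
    revert H1 H2; generalize (Derive_n q (S k)), (Derive_n q (S (S k)) t),
      (Derive_n r (S k)), (Derive_n r (S (S k)) t).
    intros u u' v v' H1 H2.
    apply is_derive_scal, (is_derive_plus u (fun x => eps * v x)); [trivial|].
    now apply is_derive_scal.
Qed.

Lemma EL_Rpower (a : R) (p : R -> R) (t : R) : smooth p -> 0 < p t ->
  EL a p t = / 2 * Rpower_third (a - 1) (p t) (Derive p t) (Derive_n p 2 t) (Derive_n p 3 t)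
    + 2 * p t * ((a - 1) * Rpower (p t) (a - 1 - 1) * Derive p t)
    + Derive p t * Rpower (p t) (a - 1).
Proof.
  intros Hs Hp; unfold EL.
  rewrite Derive_n_3_Rpower by trivial.
  replace (Derive (fun s => Rpower (p s) (a - 1)) t)
    with ((a - 1) * Rpower (p t) (a - 1 - 1) * Derive p t); [reflexivity|].
  symmetry; apply is_derive_unique, is_derive_Rpower; [|trivial].
  now apply Derive_correct, smooth_ex_derive.
Qed.

Lemma EL_circle_deformation (a : R) (f : R -> R) (t : R) : smooth f ->
  zero_mod_eps2 (fun eps => EL a (curvature (deform circle (vfield f circle) eps)) t) <->
  (a - 1) / 2 * Derive_n (potential f) 4 t + (2 * a - 1) * Derive_n (potential f) 2 t = 0.
Proof.
  intros Hf.
  assert (Hm := smooth_potential f Hf).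
  assert (Hq := smooth_Derive_n _ 1 Hm : smooth (Derive (potential f))).
  assert (Hr := smooth_curvature2 f Hf).
  set (q := Derive (potential f)) in *; set (r := curvature2 f) in *.
  replace (Derive_n (potential f) 4 t) with (Derive_n q 3 t)
    by exact (Derive_n_comp (potential f) 3 1 t).
  replace (Derive_n (potential f) 2 t) with (Derive q t) by reflexivity.
  set (P := fun eps => 1 + eps * q t + eps ^ 2 * r t).
  set (P1 := fun eps => Derive q t + eps * Derive r t).
  set (P2 := fun eps => Derive_n q 2 t + eps * Derive_n r 2 t).
  set (P3 := fun eps => Derive_n q 3 t + eps * Derive_n r 3 t).
  set (b := a - 1).
  (* [G] is the Euler-Lagrange expression with one factor [eps] removed: [P] is the curvature and
     eps P1, eps P2, eps P3 are its derivatives. The terms nonlinear in these derivatives keep a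
     power of [eps] and vanish at 0. *)
  set (G := fun eps =>
    / 2 * (b * (b - 1) * (b - 2) * Rpower (P eps) (b - 3) * (eps ^ 2 * P1 eps ^ 3)
      + 3 * b * (b - 1) * Rpower (P eps) (b - 2) * (eps * P1 eps * P2 eps)
      + b * Rpower (P eps) (b - 1) * P3 eps)
    + 2 * P eps * (b * Rpower (P eps) (b - 1) * P1 eps) + P1 eps * Rpower (P eps) b).
  assert (HP : locally 0 (fun eps => 0 < P eps)).
  { assert (C : continuous P 0).
    { apply (ex_derive_continuous (V := R_NormedModule)); unfold P; auto_derive; trivial. }
    apply C, (open_gt 0); unfold P; lra. }
  rewrite (zero_mod_eps2_factor _ G).
  - unfold G, P, P1, P2, P3.
    (* At [eps] = 0 the curvature is 1, so every power of it is 1. The coefficient of the second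
       derivative is 2 (a - 1) + 1 = 2 a - 1. *)
    replace (1 + 0 * q t + 0 ^ 2 * r t) with 1 by ring.
    unfold Rpower; rewrite ln_1, !Rmult_0_r, exp_0; unfold b.
    split; intros H; (etransitivity; [|exact H]); field.
  - apply filter_imp with (2 := HP); intros eps Heps.
    rewrite curvature_deform_circle by trivial.
    fold q r.
    assert (Hp : smooth (fun s => 1 + eps * q s + eps ^ 2 * r s)).
    { apply (smooth_plus (fun s => 1 + eps * q s) (fun s => eps ^ 2 * r s)).
      - apply (smooth_plus (fun _ => 1) (fun s => eps * q s)); [apply smooth_const|].
        apply (smooth_mult (fun _ => eps) q); [apply smooth_const|trivial].
      - apply (smooth_mult (fun _ => eps ^ 2) r); [apply smooth_const|trivial]. }
    rewrite EL_Rpower by trivial.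
    rewrite !(Derive_n_quadratic q r) by trivial.
    rewrite (Derive_n_quadratic q r 1 eps 0 t Hq Hr : Derive _ t = _).
    change (Derive_n q 1 t + eps * Derive_n r 1 t) with (P1 eps).
    fold (P1 eps) (P2 eps) (P3 eps) (P eps) b.
    unfold Rpower_third, G; ring.
  - unfold G, P, P1, P2, P3, Rpower; auto_derive; repeat split; lra.
Qed.

(** * Periodic solutions of y'' + c y = 0 *)

Lemma derive_0_const (f : R -> R) (s t : R) : (forall x, is_derive f x 0) -> f s = f t.
Proof.
  intros H; destruct (Rtotal_order s t) as [L|[->|L]]; trivial; [|symmetry];
    apply (eq_is_derive f); trivial; intros; apply H.
Qed.

Lemma derive_nonneg_le (f g : R -> R) (s t : R) :
  (forall x, is_derive f x (g x)) -> (forall x, 0 <= g x) -> s <= t -> f s <= f t.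
Proof.
  intros H Hg L.
  destruct (MVT_gen f s t g) as (c & _ & E).
  - intros; apply H.
  - intros x _; apply derivable_continuous_pt; exists (g x); now apply is_derive_Reals.
  - specialize (Hg c); nra.
Qed.

(** A nondecreasing function that takes the same value at t - T/2 and t + T/2 is constant in
    between, so its derivative at the midpoint is 0. *)
Lemma periodic_derive_nonneg (T : R) (f g : R -> R) : 0 < T -> periodic T f ->
  (forall x, is_derive f x (g x)) -> (forall x, 0 <= g x) -> forall t, g t = 0.
Proof.
  intros HT Hp Hd Hg t.
  assert (E : locally t (fun s => f (t - T / 2) = f s)).
  { exists (mkposreal (T / 2) ltac:(lra)); intros s Hs.
    change (Rabs (s - t) < T / 2) in Hs; apply Rabs_lt_between in Hs.
    apply Rle_antisym.
    - apply (derive_nonneg_le f g); trivial; lra.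
    - rewrite <- (Hp (t - T / 2)); apply (derive_nonneg_le f g); trivial; lra. }
  rewrite <- (is_derive_unique _ _ _ (Hd t)).
  apply is_derive_unique, (is_derive_ext_loc _ _ _ _ E), @is_derive_const.
Qed.

(** A constant slope [c] makes [f] grow by c T over one period. *)
Lemma periodic_derive_const (T : R) (f : R -> R) (c : R) : 0 < T -> periodic T f ->
  (forall x, is_derive f x c) -> c = 0.
Proof.
  intros HT Hp Hd.
  assert (E : f T - c * T = f 0 - c * 0).
  { apply (derive_0_const (fun x => f x - c * x)); intros x.
    evar_last; [apply @is_derive_minus; [apply Hd|]|].
    - apply is_derive_scal, @is_derive_id.
    - unfold minus, plus, opp, one; simpl; ring. }
  assert (E' := Hp 0); rewrite Rplus_0_l in E'.
  apply Rmult_eq_reg_r with T; lra.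
Qed.

(** The vector (y, z / w) rotates with angular speed [w]. Rotating it back by the angle w t gives a
    constant vector, whose two coordinates are [H1] and [H2]; undoing the rotation yields the
    formula. *)
Lemma oscillator (w : R) (y z : R -> R) : w <> 0 ->
  (forall t, is_derive y t (z t)) -> (forall t, is_derive z t (- w ^ 2 * y t)) ->
  exists A B, forall t, y t = A * cos (w * t) + B * sin (w * t).
Proof.
  intros Hw Hy Hz.
  exists (y 0), (z 0 / w); intros t.
  assert (E0 : forall s, Derive (fun x => y x) s = z s) by (intros; now apply is_derive_unique).
  assert (E1 : forall s, Derive (fun x => z x) s = - w ^ 2 * y s) by (intros; now apply is_derive_unique).
  assert (H1 : y t * cos (w * t) - z t / w * sin (w * t)
             = y 0 * cos (w * 0) - z 0 / w * sin (w * 0)).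
  { apply (derive_0_const (fun x => y x * cos (w * x) - z x / w * sin (w * x))); intros x.
    auto_derive; [repeat split; eexists; eauto|rewrite E0, E1; field; trivial]. }
  assert (H2 : y t * sin (w * t) + z t / w * cos (w * t)
             = y 0 * sin (w * 0) + z 0 / w * cos (w * 0)).
  { apply (derive_0_const (fun x => y x * sin (w * x) + z x / w * cos (w * x))); intros x.
    auto_derive; [repeat split; eexists; eauto|rewrite E0, E1; field; trivial]. }
  rewrite Rmult_0_r, cos_0, sin_0 in H1, H2.
  assert (HS := sin2_cos2 (w * t)); unfold Rsqr in HS.
  transitivity ((y t * cos (w * t) - z t / w * sin (w * t)) * cos (w * t)
     + (y t * sin (w * t) + z t / w * cos (w * t)) * sin (w * t)).
  - transitivity (y t * (sin (w * t) * sin (w * t) + cos (w * t) * cos (w * t)));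
      [rewrite HS; ring|field; trivial].
  - rewrite H1, H2; ring.
Qed.

(** A shift by the period rotates the coefficient vector (A, B) by the angle [th]. A nonzero vector
    is fixed only by the identity rotation, so [th] is a multiple of 2 pi. *)
Lemma periodic_trig (n : nat) (w A B : R) : (1 <= n)%nat -> 0 < w ->
  periodic (period n) (fun t => A * cos (w * t) + B * sin (w * t)) ->
  (A = 0 /\ B = 0) \/ exists k : nat, (1 <= k)%nat /\ INR k = w * INR n.
Proof.
  intros Hn Hw Hp.
  assert (Hn' : 0 < INR n) by (apply lt_0_INR; lia).
  assert (PP := PI_RGT_0).
  destruct (Req_dec (A ^ 2 + B ^ 2) 0) as [Z|NZ]; [left; nra|right].
  set (th := w * period n).
  assert (E1 : A * cos th + B * sin th = A).
  { assert (H := Hp 0); cbv beta in H; rewrite Rplus_0_l, Rmult_0_r, cos_0, sin_0 in H.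
    fold th in H; lra. }
  (* A quarter turn, w t = pi/2, isolates the second coordinate of the rotated vector. *)
  assert (E2 : - A * sin th + B * cos th = B).
  { assert (H := Hp (PI / 2 / w)); cbv beta in H.
    rewrite Rmult_plus_distr_l in H; fold th in H.
    replace (w * (PI / 2 / w)) with (PI / 2) in H by (field; lra).
    rewrite cos_plus, sin_plus, cos_PI2, sin_PI2 in H; lra. }
  assert (C1 : cos th = 1).
  { apply Rmult_eq_reg_l with (2 := NZ).
    transitivity (A * (A * cos th + B * sin th) + B * (- A * sin th + B * cos th)); [ring|].
    rewrite E1, E2; ring. }
  (* The half angle is used so that the integer found below counts multiples of 2 pi in [th]. *)
  assert (S0 : sin (th / 2) = 0).
  { replace th with (2 * (th / 2)) in C1 by field.
    rewrite cos_2a_sin in C1; nra. }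
  destruct (sin_eq_0_0 _ S0) as [k Hk].
  assert (Ek : IZR k = w * INR n).
  { apply Rmult_eq_reg_r with PI; [|lra]. rewrite <- Hk; unfold th, period; field. }
  assert (Pk : (0 < k)%Z) by (apply lt_IZR; rewrite Ek; now apply Rmult_lt_0_compat).
  exists (Z.to_nat k); split; [lia|].
  rewrite INR_IZR_INZ, Z2Nat.id by lia; exact Ek.
Qed.

(** One argument covers c < 0 and c = 0; the conclusion concerns y' because nonzero constants
    survive when c = 0. *)
Lemma periodic_oscillator_nonpos (T c : R) (y : R -> R) : 0 < T -> c <= 0 ->
  smooth y -> periodic T y -> (forall t, Derive_n y 2 t = - c * y t) ->
  forall t, Derive y t = 0.
Proof.
  intros HT Hc Hs Hp He t.
  assert (Hp1 := periodic_Derive_n T y 1 Hs Hp).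
  enough (E : Derive y t * Derive y t + y t * (- c * y t) = 0) by nra.
  (* [y y'] is periodic with nonnegative derivative. *)
  apply (periodic_derive_nonneg T (fun x => y x * Derive y x)
    (fun x => Derive y x * Derive y x + y x * (- c * y x)) HT).
  - intros x; rewrite Hp; f_equal; exact (Hp1 x).
  - intros x; rewrite <- He.
    apply (is_derive_mult y (Derive y)); [| |intros; apply Rmult_comm].
    + exact (smooth_is_derive_n y 0 x Hs).
    + exact (smooth_is_derive_n y 1 x Hs).
  - intros x; nra.
Qed.

(** The slope of [g] is constant, and periodicity forces it to be 0. *)
Lemma periodic_second_derivative_0 (T : R) (g : R -> R) : 0 < T -> smooth g -> periodic T g ->
  (forall t, Derive_n g 2 t = 0) -> forall t, g t = g 0.
Proof.
  intros HT Hs Hp H2 t.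
  assert (H1 : forall x, Derive g x = 0).
  { intros x; apply (periodic_derive_const T g (Derive g x) HT Hp); intros s.
    rewrite (derive_0_const (Derive g) x s).
    - exact (smooth_is_derive_n g 0 s Hs).
    - intros u; rewrite <- (H2 u); exact (smooth_is_derive_n g 1 u Hs). }
  apply derive_0_const; intros x; rewrite <- (H1 x); exact (smooth_is_derive_n g 0 x Hs).
Qed.

(** The operator f''/2 + 2 f multiplies constants by 2 and cos t, sin t by 3/2, which gives the
    particular solution. The remainder solves y'' = - 4 y, hence the terms in 2 t. *)
Lemma potential_trig_solution (f : R -> R) (A B C : R) : smooth f ->
  (forall t, potential f t = C + A * cos t + B * sin t) ->
  exists c1 c2, forall t,
    f t = C / 2 + c1 * cos (2 * t) + c2 * sin (2 * t) + 2 / 3 * A * cos t + 2 / 3 * B * sin t.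
Proof.
  intros Hs H; unfold potential in H.
  assert (H0 : forall s, is_derive f s (Derive f s)) by (intros s; exact (smooth_is_derive_n f 0 s Hs)).
  assert (H1 : forall s, is_derive (Derive f) s (Derive_n f 2 s))
    by (intros s; exact (smooth_is_derive_n f 1 s Hs)).
  set (f1 := Derive f) in *; set (f2 := Derive_n f 2) in *; clearbody f1 f2.
  destruct (oscillator 2 (fun t => f t - C / 2 - 2 / 3 * A * cos t - 2 / 3 * B * sin t)
    (fun t => f1 t + 2 / 3 * A * sin t - 2 / 3 * B * cos t)) as (c1 & c2 & E).
  - lra.
  - intros t; auto_derive; [repeat split; eexists; eauto|].
    replace (Derive (fun x => f x) t) with (f1 t) by (symmetry; now apply is_derive_unique); ring.
  - intros t; auto_derive; [repeat split; eexists; eauto|].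
    replace (Derive (fun x => f1 x) t) with (f2 t) by (symmetry; now apply is_derive_unique).
    replace (f2 t) with (2 * (C + A * cos t + B * sin t) - 4 * f t) by (rewrite <- H; field).
    field.
  - exists c1, c2; intros t; specialize (E t); cbv beta in E; lra.
Qed.

(** * First variation at the circle *)

Lemma smooth_continuity_pt (f : R -> R) (t : R) : smooth f -> continuity_pt f t.
Proof.
  intros H; apply derivable_continuous_pt; exists (Derive f t).
  apply is_derive_Reals, Derive_correct, (H 1%nat).
Qed.

Lemma smooth_bounded (f : R -> R) (u v : R) : smooth f -> u <= v ->
  exists M, forall t, u <= t <= v -> Rabs (f t) <= M.
Proof.
  intros H L.
  destruct (continuity_ab_maj (fun t => Rabs (f t)) u v L) as (x & Hx & _); [|eauto].
  intros c _; apply (continuity_pt_comp f Rabs); [now apply smooth_continuity_pt|].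
  apply Rcontinuity_abs.
Qed.

(** Differentiation under the integral sign; at [eps] = 0 the base is 1, so the integrand has
    derivative a q. *)
Lemma is_derive_RInt_Rpower_quadratic (a : R) (q r : R -> R) (T : R) :
  smooth q -> smooth r -> 0 <= T ->
  is_derive (fun eps => RInt (fun t => Rpower (1 + eps * q t + eps ^ 2 * r t) a) 0 T) 0
    (a * RInt q 0 T).
Proof.
  intros Hq Hr HT.
  set (P := fun eps t => 1 + eps * q t + eps ^ 2 * r t).
  (* One neighbourhood of 0 has to serve all t in the interval. The radius 1 / (1 + M + N) is at
     most 1, so eps^2 <= |eps| there and the perturbation is at most |eps| (M + N) < 1. *)
  assert (HP : locally 0 (fun eps => forall t, 0 <= t <= T -> 0 < P eps t)).
  { destruct (smooth_bounded q 0 T Hq HT) as [M HM].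
    destruct (smooth_bounded r 0 T Hr HT) as [N HN].
    assert (M0 : 0 <= M) by (apply Rle_trans with (1 := Rabs_pos (q 0)), HM; lra).
    assert (N0 : 0 <= N) by (apply Rle_trans with (1 := Rabs_pos (r 0)), HN; lra).
    assert (D0 : 0 < / (1 + M + N)) by (apply Rinv_0_lt_compat; lra).
    exists (mkposreal _ D0); intros eps He t Ht.
    change (Rabs (eps - 0) < / (1 + M + N)) in He; rewrite Rminus_0_r in He.
    assert (He1 : Rabs eps * (1 + M + N) < 1).
    { replace 1 with (/ (1 + M + N) * (1 + M + N)) at 2 by (field; lra).
      apply Rmult_lt_compat_r; lra. }
    assert (He0 := Rabs_pos eps).
    assert (Q1 : Rabs (eps * q t) <= Rabs eps * M).
    { rewrite Rabs_mult; apply Rmult_le_compat_l; auto. }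
    assert (Q2 : Rabs (eps ^ 2 * r t) <= Rabs eps * N).
    { rewrite Rabs_mult, <- RPow_abs. specialize (HN t Ht).
      assert (Rabs eps ^ 2 <= Rabs eps) by nra.
      apply Rmult_le_compat; auto; [apply pow2_ge_0|apply Rabs_pos]. }
    apply Rabs_le_between in Q1; apply Rabs_le_between in Q2.
    unfold P; nra. }
  assert (DP : forall eps t, 0 < P eps t ->
    is_derive (fun z => Rpower (P z t) a) eps
      (a * Rpower (P eps t) (a - 1) * (q t + 2 * eps * r t))).
  { intros eps t H; apply (is_derive_Rpower a (fun z => P z t)); [|trivial].
    unfold P; auto_derive; [trivial|ring]. }
  assert (P2 : forall eps t, continuity_2d_pt P eps t).
  { intros eps t; unfold P.
    assert (C1 : forall h, smooth h -> continuity_2d_pt (fun _ v => h v) eps t).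
    { intros h Hh; apply (continuity_1d_2d_pt_comp h (fun _ v => v));
        [now apply smooth_continuity_pt|apply continuity_2d_pt_id2]. }
    apply (continuity_2d_pt_plus (fun u v => 1 + u * q v) (fun u v => u ^ 2 * r v)).
    - apply continuity_2d_pt_plus; [apply continuity_2d_pt_const|].
      apply continuity_2d_pt_mult; [apply continuity_2d_pt_id1|auto].
    - apply continuity_2d_pt_mult; [|auto].
      apply (continuity_1d_2d_pt_comp (fun u => u ^ 2) (fun u _ => u));
        [reg|apply continuity_2d_pt_id1]. }
  assert (CR : forall b x, 0 < x -> continuity_pt (fun x => Rpower x b) x).
  { intros b x Hx; apply derivable_continuous_pt; eexists.
    apply derivable_pt_lim_power; trivial. }
  assert (P0 : forall t, P 0 t = 1) by (intros t; unfold P; ring).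
  evar_last.
  - apply (is_derive_RInt_param (fun eps t => Rpower (P eps t) a) 0 T 0);
      rewrite ?Rmin_left, ?Rmax_right by trivial.
    + apply filter_imp with (2 := HP); intros eps H t Ht; eexists; now apply DP, H.
    + intros t Ht.
      (* Joint continuity is checked on the closed form of the derivative, valid wherever [P] is
         positive. *)
      apply continuity_2d_pt_ext_loc with
        (fun u v => a * Rpower (P u v) (a - 1) * (q v + 2 * u * r v)).
      * assert (L : locally_2d (fun u v => 0 < P u v) 0 t).
        { apply locally_2d_locally.
          assert (C := proj1 (continuity_2d_pt_filterlim _ _ _) (P2 0 t)).
          apply C; apply (open_gt 0); rewrite P0; lra. }
        apply locally_2d_impl with (2 := L), locally_2d_forall; intros u v H.
        symmetry; now apply is_derive_unique, DP.
      * apply continuity_2d_pt_mult; [apply continuity_2d_pt_mult|].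
        -- apply continuity_2d_pt_const.
        -- apply (continuity_1d_2d_pt_comp (fun x => Rpower x (a - 1)) P); [|apply P2].
           apply CR; rewrite P0; lra.
        -- apply continuity_2d_pt_plus.
           ++ apply (continuity_1d_2d_pt_comp q (fun _ v => v));
                [now apply smooth_continuity_pt|apply continuity_2d_pt_id2].
           ++ apply continuity_2d_pt_mult.
              ** apply continuity_2d_pt_mult; [apply continuity_2d_pt_const|apply continuity_2d_pt_id1].
              ** apply (continuity_1d_2d_pt_comp r (fun _ v => v));
                   [now apply smooth_continuity_pt|apply continuity_2d_pt_id2].
    + apply filter_imp with (2 := HP); intros eps H.
      apply (ex_RInt_continuous (V := R_CompleteNormedModule)).
      rewrite Rmin_left, Rmax_right by trivial; intros t Ht.
      apply continuity_pt_filterlim.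
      apply (continuity_pt_comp (P eps) (fun x => Rpower x a)); [|now apply CR, H].
      assert (Cq := smooth_continuity_pt q t Hq); assert (Cr := smooth_continuity_pt r t Hr).
      unfold P; reg.
  - change (a * RInt q 0 T) with (scal a (RInt (V := R_CompleteNormedModule) q 0 T)).
    rewrite <- (RInt_scal (V := R_CompleteNormedModule) q 0 T a).
    + apply RInt_ext; intros t _.
      etransitivity; [apply is_derive_unique, DP; rewrite P0; lra|].
      rewrite P0; unfold Rpower; rewrite ln_1, Rmult_0_r, exp_0.
      unfold scal; simpl; unfold mult; simpl; ring.
    + apply (ex_RInt_continuous (V := R_CompleteNormedModule)); intros t _.
      now apply continuity_pt_filterlim, smooth_continuity_pt.
Qed.

Lemma period_pos (n : nat) : (1 <= n)%nat -> 0 < period n.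
Proof.
  intros Hn; unfold period; assert (H := PI_RGT_0).
  assert (0 < INR n) by (apply lt_0_INR; lia); nra.
Qed.

Lemma periodic_trig_integer (n k : nat) (A B : R) : (1 <= n)%nat ->
  periodic (period n) (fun t => A * cos (INR k / INR n * t) + B * sin (INR k / INR n * t)).
Proof.
  intros Hn t; unfold period.
  assert (0 < INR n) by (apply lt_0_INR; lia).
  replace (INR k / INR n * (t + 2 * PI * INR n)) with (INR k / INR n * t + 2 * INR k * PI)
    by (field; lra).
  now rewrite cos_period, sin_period.
Qed.

Lemma circle_critical (a : R) (n : nat) : (1 <= n)%nat -> critical_curve a n circle.
Proof.
  intros Hn; split; [split; [exact (conj smooth_cos smooth_sin)|split; [|split]]|].
  - intros t; unfold circle, period.
    replace (t + 2 * PI * INR n) with (t + 2 * INR n * PI) by ring.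
    now rewrite cos_period, sin_period.
  - intros t; rewrite Dcurve_circle; unfold det, circle; simpl.
    assert (H := sin2_cos2 t); unfold Rsqr in H; lra.
  - intros t; rewrite curvature_circle; lra.
  - intros f Hf Hp; unfold Bfun.
    assert (Hm := smooth_potential f Hf).
    assert (HT := period_pos n Hn).
    evar_last.
    + apply is_derive_ext with (2 := is_derive_RInt_Rpower_quadratic a (Derive (potential f))
        (curvature2 f) (period n) (smooth_Derive_n _ 1 Hm) (smooth_curvature2 f Hf) (Rlt_le _ _ HT)).
      intros eps; now rewrite curvature_deform_circle.
    + rewrite (is_RInt_unique (V := R_CompleteNormedModule) _ _ _
        (minus (potential f (period n)) (potential f 0))).
      * assert (E := periodic_potential (period n) f Hf Hp 0); rewrite Rplus_0_l in E.
        rewrite E; unfold minus, plus, opp; simpl; ring.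
      * apply (is_RInt_derive (V := R_CompleteNormedModule)); intros t _.
        -- exact (smooth_is_derive_n _ 0 t Hm).
        -- apply continuity_pt_filterlim, smooth_continuity_pt, (smooth_Derive_n _ 1 Hm).
Qed.

(** * Classification of the infinitesimal deformations *)

Lemma circle_deformation_potential (a : R) (n : nat) (g1 : curve) :
  infinitesimal_deformation a n circle g1 <->
  exists f, smooth f /\ periodic (period n) f /\ g1 = vfield f circle /\
    forall t, (a - 1) / 2 * Derive_n (potential f) 4 t
              + (2 * a - 1) * Derive_n (potential f) 2 t = 0.
Proof.
  split.
  - intros [(f & Hf & Hp & E) H]; apply functional_extensionality in E.
    change (g1 = vfield f circle) in E; subst g1.
    exists f; repeat split; trivial; intros t; now apply EL_circle_deformation.
  - intros (f & Hf & Hp & -> & H); split.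
    + now exists f.
    + intros t; now apply EL_circle_deformation.
Qed.

(** Since [e, e] = 0 and [e, e'] = 1 on the circle, [e, v_f] = f. The function witnessing triviality
    of a field is therefore the one that defines it. *)
Lemma circle_vfield_inj (f g : R -> R) (t : R) :
  vfield f circle t = vfield g circle t -> f t = g t.
Proof.
  intros E; assert (D : det (circle t) (vfield f circle t) = det (circle t) (vfield g circle t))
    by now rewrite E.
  clear E; unfold vfield in D; rewrite Dcurve_circle in D; unfold det, circle in D; simpl in D.
  assert (H := sin2_cos2 t); unfold Rsqr in H.
  replace (f t) with (f t * (sin t * sin t + cos t * cos t)) by (rewrite H; ring).
  replace (g t) with (g t * (sin t * sin t + cos t * cos t)) by (rewrite H; ring).
  lra.
Qed.

Lemma constant_potential_sl2 (f : R -> R) (C : R) : smooth f ->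
  (forall t, potential f t = C) -> in_span_sl2 f.
Proof.
  intros Hf H.
  destruct (potential_trig_solution f 0 0 C Hf) as (c1 & c2 & E).
  - intros t; rewrite H; ring.
  - exists (C / 2), c1, c2; intros t; rewrite E; ring.
Qed.

(** Here m'' = h with h in the span of cos t and sin t, so h'' = - h and m + h has second derivative
    0. Being periodic, m + h is constant, and f is recovered from m = const - h. *)
Lemma deformation_third (n : nat) (f : R -> R) : (1 <= n)%nat ->
  smooth f -> periodic (period n) f ->
  (forall t, Derive_n (potential f) 4 t = - Derive_n (potential f) 2 t) ->
  in_span_sl2_translations f.
Proof.
  intros Hn Hf Hp H.
  assert (Hm := smooth_potential f Hf).
  assert (HT := period_pos n Hn).
  destruct (oscillator 1 (Derive_n (potential f) 2) (Derive_n (potential f) 3)) as (A & B & E).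
  - lra.
  - intros t; now apply smooth_is_derive_n.
  - intros t; replace (- 1 ^ 2 * Derive_n (potential f) 2 t) with (Derive_n (potential f) 4 t)
      by (rewrite H; ring).
    now apply smooth_is_derive_n.
  - set (h := fun t => A * cos (1 * t) + B * sin (1 * t)).
    assert (Hh := smooth_trig A B 1 : smooth h).
    assert (E2 : forall t, Derive_n h 2 t = - h t).
    { intros t; transitivity (Derive (fun s => - A * sin (1 * s) + B * cos (1 * s)) t).
      - apply Derive_ext; intros s; apply is_derive_unique; unfold h; auto_derive; [trivial|ring].
      - apply is_derive_unique; unfold h; auto_derive; [trivial|ring]. }
    destruct (potential_trig_solution f (- A) (- B) (potential f 0 + h 0) Hf) as (c1 & c2 & E3).
    + intros t.
      enough (E4 : potential f t + h t = potential f 0 + h 0).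
      { unfold h in E4 at 1; rewrite Rmult_1_l in E4; lra. }
      apply (periodic_second_derivative_0 (period n) (fun t => potential f t + h t) HT).
      * now apply smooth_plus.
      * intros s; rewrite (periodic_potential (period n) f Hf Hp s); f_equal; unfold h.
        assert (Hn' : 0 < INR n) by (apply lt_0_INR; lia).
        (* Frequency 1 is the resonance k = n. *)
        replace 1 with (INR n / INR n) by (field; lra).
        now apply (periodic_trig_integer n n A B).
      * intros s; rewrite Derive_n_plus.
        -- rewrite E2, E; unfold h; ring.
        -- apply filter_forall; intros; apply Hm.
        -- apply filter_forall; intros; apply Hh.
    + exists ((potential f 0 + h 0) / 2), c1, c2, (2 / 3 * - A), (2 / 3 * - B); exact E3.
Qed.

Lemma deformation_resonance (a : R) (n : nat) (f : R -> R) : (1 <= n)%nat -> a <> 1 / 3 ->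
  smooth f -> periodic (period n) f ->
  (forall t, (a - 1) / 2 * Derive_n (potential f) 4 t
             + (2 * a - 1) * Derive_n (potential f) 2 t = 0) ->
  in_span_sl2 f \/
  exists k : nat, (1 <= k)%nat /\ k <> n /\ k <> (2 * n)%nat /\
    a = (INR k ^ 2 - 2 * INR n ^ 2) / (INR k ^ 2 - 4 * INR n ^ 2).
Proof.
  intros Hn Ha Hf Hp H.
  set (m := potential f) in *.
  assert (Hm := smooth_potential f Hf : smooth m).
  assert (Pm := periodic_potential _ f Hf Hp : periodic (period n) m).
  assert (HT := period_pos n Hn).
  assert (Hn' : 0 < INR n) by (apply lt_0_INR; lia).
  assert (K : (forall t, Derive_n m 2 t = 0) -> in_span_sl2 f).
  { intros H2; apply (constant_potential_sl2 f (m 0) Hf).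
    now apply (periodic_second_derivative_0 (period n)). }
  (* For a = 1 the leading coefficient vanishes and the equation reads m'' = 0, so [c] is introduced
     only afterwards. *)
  destruct (Req_dec a 1) as [->|Ha1].
  { left; apply K; intros t; specialize (H t); lra. }
  set (c := 2 * (2 * a - 1) / (a - 1)).
  assert (Ec : c * (a - 1) = 2 * (2 * a - 1)) by (unfold c; field; lra).
  assert (H4 : forall t, Derive_n m 4 t = - c * Derive_n m 2 t).
  { intros t; specialize (H t); apply Rmult_eq_reg_l with ((a - 1) / 2); [|lra].
    transitivity (- (c * (a - 1)) / 2 * Derive_n m 2 t); [rewrite Ec; lra|field]. }
  destruct (Rle_or_lt c 0) as [Hc|Hc].
  (* Without oscillation m'' is constant; as the slope of the periodic function m' it is 0. *)
  - left; apply K.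
    assert (H3 : forall t, Derive_n m 3 t = 0).
    { apply (periodic_oscillator_nonpos (period n) c (Derive_n m 2) HT Hc).
      - now apply smooth_Derive_n.
      - now apply periodic_Derive_n.
      - intros t; rewrite Derive_n_comp; apply H4. }
    intros t; apply (periodic_derive_const (period n) (Derive m) (Derive_n m 2 t) HT).
    + exact (periodic_Derive_n _ m 1 Hm Pm).
    + intros x; rewrite (derive_0_const (Derive_n m 2) t x).
      * exact (smooth_is_derive_n m 1 x Hm).
      * intros u; rewrite <- (H3 u); now apply smooth_is_derive_n.
  - set (w := sqrt c).
    assert (Hw : 0 < w) by now apply sqrt_lt_R0.
    assert (Ew : w ^ 2 = c) by (apply pow2_sqrt; lra).
    destruct (oscillator w (Derive_n m 2) (Derive_n m 3)) as (A & B & E).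
    + lra.
    + intros t; now apply smooth_is_derive_n.
    + intros t; rewrite Ew, <- H4; now apply smooth_is_derive_n.
    + destruct (periodic_trig n w A B Hn Hw) as [[-> ->]|(k & Hk & Ek)].
      * intros t; rewrite <- !E; now apply periodic_Derive_n.
      * left; apply K; intros t; rewrite E; ring.
      * right; exists k.
        (* This is k^2 = c n^2 with the denominator a - 1 cleared. For k = n it gives a = 1/3; for
           k^2 = 4 n^2 it would give 4 a - 4 = 4 a - 2. *)
        assert (Ek2 : INR k ^ 2 * (a - 1) = 2 * (2 * a - 1) * INR n ^ 2).
        { rewrite Ek, Rpow_mult_distr, Ew, <- Ec; ring. }
        assert (Hn2 : 0 < INR n ^ 2) by now apply pow_lt.
        split; [trivial|split; [|split]].
        -- intros ->; apply Ha; apply Rmult_eq_reg_l with (INR n ^ 2); lra.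
        -- intros ->; rewrite mult_INR in Ek2; simpl in Ek2, Hn2; lra.
        -- assert (NZ : INR k ^ 2 - 4 * INR n ^ 2 <> 0).
           { intros Z; replace (INR k ^ 2) with (4 * INR n ^ 2) in Ek2 by lra; lra. }
           apply Rmult_eq_reg_r with (2 := NZ).
           transitivity (INR k ^ 2 - 2 * INR n ^ 2); [lra|now field].
Qed.

Lemma Derive_n_2_cos (A w t : R) :
  Derive_n (fun s => A * cos (w * s)) 2 t = - w ^ 2 * A * cos (w * t).
Proof.
  transitivity (Derive (fun s => - w * A * sin (w * s)) t).
  - apply Derive_ext; intros s; apply is_derive_unique; auto_derive; [trivial|ring].
  - apply is_derive_unique; auto_derive; [trivial|ring].
Qed.

(** For w > 0 the eigenvalue vanishes only at w = 2, the frequency of the infinitesimal SL(2,R)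
    action. *)
Lemma potential_cos (w : R) :
  potential (fun s => 1 * cos (w * s)) = fun t => (2 - w ^ 2 / 2) * cos (w * t).
Proof.
  extensionality t; unfold potential; rewrite Derive_n_2_cos; field.
Qed.

Lemma potential_sl2 (f : R -> R) : in_span_sl2 f -> exists C, forall t, potential f t = C.
Proof.
  intros (c0 & c1 & c2 & E); exists (2 * c0); intros t.
  apply functional_extensionality in E; subst f; unfold potential.
  replace (Derive_n _ 2 t) with (- 4 * c1 * cos (2 * t) - 4 * c2 * sin (2 * t)); [field|].
  symmetry.
  transitivity (Derive (fun s => - 2 * c1 * sin (2 * s) + 2 * c2 * cos (2 * s)) t).
  - apply Derive_ext; intros s; apply is_derive_unique; auto_derive; [trivial|ring].
  - apply is_derive_unique; auto_derive; [trivial|ring].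
Qed.

(** With w = k/n the potential of cos (w t) is an eigenfunction, and the deformation equation
    reduces to (a - 1)/2 w^2 = 2 a - 1, the given relation. Nontriviality holds because this
    potential is not constant when w differs from 2. *)
Lemma resonance_deformation (a : R) (n k : nat) : (1 <= n)%nat -> (1 <= k)%nat ->
  a <> 1 / 3 -> k <> (2 * n)%nat ->
  a = (INR k ^ 2 - 2 * INR n ^ 2) / (INR k ^ 2 - 4 * INR n ^ 2) ->
  nontrivial_circle_deformation a n (vfield (fun s => 1 * cos (INR k / INR n * s)) circle).
Proof.
  intros Hn Hk Ha Hk2 Ea.
  assert (Hn' : 0 < INR n) by (apply lt_0_INR; lia).
  assert (Hk' : 0 < INR k) by (apply lt_0_INR; lia).
  assert (NZ : INR k ^ 2 - 4 * INR n ^ 2 <> 0).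
  { intros Z; apply Hk2, INR_eq; rewrite mult_INR; simpl; nra. }
  set (w := INR k / INR n).
  assert (Hw : 0 < w) by now apply Rdiv_lt_0_compat.
  split.
  - apply circle_deformation_potential; exists (fun s => 1 * cos (w * s)).
    replace (fun s => 1 * cos (w * s)) with (fun s => 1 * cos (w * s) + 0 * sin (w * s)) at 1 2
      by (extensionality s; ring).
    split; [apply smooth_trig|split; [now apply periodic_trig_integer|split; [trivial|]]].
    intros t; rewrite potential_cos.
    rewrite <- (Derive_n_comp _ 2 2).
    rewrite (Derive_n_ext _ _ 2 t (Derive_n_2_cos (2 - w ^ 2 / 2) w)).
    rewrite !Derive_n_2_cos, Ea; unfold w; field; split; lra.
  - intros (g & E & [[_ Hg]|[Ha' _]]); [|contradiction].
    assert (Efg : (fun s => 1 * cos (w * s)) = g).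
    { extensionality t; apply (circle_vfield_inj (fun s => 1 * cos (w * s)) g t), E. }
    rewrite <- Efg in Hg; destruct (potential_sl2 _ Hg) as [C HC].
    rewrite potential_cos in HC.
    (* At phases 0 and pi the cosine takes opposite values, so a constant potential would force 2 -
       w^2/2 = 0. *)
    assert (C0 := HC 0); assert (C1 := HC (PI / w)); cbv beta in C0, C1.
    replace (w * (PI / w)) with PI in C1 by (field; lra).
    rewrite Rmult_0_r, cos_0 in C0; rewrite cos_PI in C1.
    apply NZ.
    replace (INR k) with (w * INR n) by (unfold w; field; lra).
    rewrite Rpow_mult_distr; replace (w ^ 2) with 4 by lra; ring.
Qed.

Theorem theorem1 (a : R) (n : nat) (ha : a <> 0) (hn : (1 <= n)%nat) :
  critical_curve a n circle /\
  (a = 1 / 3 -> circle_infinitesimally_rigid a n) /\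
  (a <> 1 / 3 ->
     ((exists g1 : curve, nontrivial_circle_deformation a n g1) <->
      (exists k : nat, (1 <= k)%nat /\ k <> n /\ k <> (2 * n)%nat /\
         a = (INR k ^ 2 - 2 * INR n ^ 2) / (INR k ^ 2 - 4 * INR n ^ 2)))).
Proof.
  split; [now apply circle_critical|split].
  - intros Ha (g1 & Hd & Hnt); apply Hnt.
    apply circle_deformation_potential in Hd as (f & Hf & Hp & -> & H).
    exists f; split; [trivial|right; split; [trivial|]].
    apply (deformation_third n f hn Hf Hp).
    (* For a = 1/3 both coefficients, (a - 1)/2 and 2 a - 1, equal - 1/3. *)
    intros t; specialize (H t); rewrite Ha in H; lra.
  - intros Ha; split.
    + intros (g1 & Hd & Hnt).
      apply circle_deformation_potential in Hd as (f & Hf & Hp & -> & H).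
      destruct (deformation_resonance a n f hn Ha Hf Hp H) as [Hs|Hk]; [|trivial].
      exfalso; apply Hnt; exists f; auto.
    + intros (k & Hk & _ & Hk2 & Ea).
      eexists; now apply (resonance_deformation a n k).
Qed.
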